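(* Let $F=(f_1,\dots,f_m):\mathbb{C}^2\to\mathbb{C}^m$ be a polynomial mapping and let $S:=\{z\in\mathbb{C}^2 : f_1(z)\cdot\ldots\cdot f_m(z)=0\}$. Assume that $S\ne\emptyset$ and $S\ne\mathbb{C}^2$. If $\Gamma_1,\dots,\Gamma_s$ are the branches of the curve $S$ in a neighbourhood of infinity $Y$ and $\Phi_i:U_i\to Y$, $i=1,\dots,s$, are their parametrizations, then $$\mathcal{L}_\infty(F)=\min_{i=1}^s\frac{\deg (F\circ\Phi_i)}{\deg\Phi_i}.$$
   Context: Łojasiewicz exponent at infinity: with $|\cdot|$ the maximum norm, $$N(F):=\{\nu\in\mathbb{R} : \exists A>0,\ \exists B>0,\ \forall z\in\mathbb{C}^2,\ (|z|>B\Rightarrow A|z|^\nu\le|F(z)|)\},$$ and $\mathcal{L}_\infty(F):=\sup N(F)$, with the convention $\sup\emptyset=-\infty$. Degree: if $\Psi:\{t\in\mathbb{C}:|t|>R\}\to\mathbb{C}^k$ is the sum of a Laurent series $\Psi(t)=\alpha_pt^p+\alpha_{p-1}t^{p-1}+\cdots$ with $\alpha_i\in\mathbb{C}^k$, $\alpha_p\neq0$ ($p\in\mathbb{Z}$), then $\deg\Psi:=p$; and $\deg\Psi:=-\infty$ if $\Psi=0$. The quotient of $-\infty$ by a positive integer is $-\infty$. Branches at infinity: a neighbourhood of infinity in $\mathbb{C}^2$ is the complement $Y$ of a compact set. For an algebraic curve $S\subset\mathbb{C}^2$ and a suitable neighbourhood of infinity $Y$, the set $S\cap Y$ is a finite disjoint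 union $\Gamma_1\cup\dots\cup\Gamma_s$ ($s\geq 1$) of sets called the branches of $S$ in $Y$, each having a parametrization $\Phi_i:U_i\to Y$: here $U_i=\{t\in\mathbb{C}:|t|>R_i\}$ for some $R_i>0$, $\Phi_i$ is holomorphic on $U_i$ and meromorphic at $\infty$ (i.e. its Laurent series has only finitely many terms with positive powers of $t$), $\Phi_i$ is a homeomorphism of $U_i$ onto $\Gamma_i$, and for any sequence $(t_k)$ in $U_i$ one has $|\Phi_i(t_k)|\to\infty$ if and only if $|t_k|\to\infty$. In particular $\deg\Phi_i>0$. *)

(* Defs.v *)
From HB Require Import structures.
From mathcomp Require Import all_boot all_order all_algebra.
From mathcomp Require Import all_classical all_reals all_analysis.
From mathcomp Require Import complex.
(* Not imported: the notations of mpoly clash with those of the analysis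
   library. [mpoly.mpoly n K] is the type {mpoly K[n]} and [mpoly.meval v p]
   is p.@[v]. *)
From mathcomp Require mpoly.

Set Implicit Arguments.
Unset Strict Implicit.
Unset Printing Implicit Defensive.

Import Order.TTheory GRing.Theory Num.Theory.
Import numFieldNormedType.Exports.

Local Open Scope classical_set_scope.
Local Open Scope ring_scope.

(* R[i] itself carries no canonical topology; its regular module R[i]^o, a
   convertible type, carries the one of the modulus. *)
Notation Cplx R := (R[i]^o) (only parsing).

(* The norm of a normed R[i]-module takes its values in R[i] (they are real
   and nonnegative); on row vectors it is the maximum norm. *)
Definition rnorm (R : realType) (V : normedModType R[i]) (v : V) : R :=
  complex.Re `|v|.

Section PolynomialMapping.
Variables (R : realType) (m : nat) (f : 'I_m -> mpoly.mpoly 2 R[i]).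

Definition polymap (z : 'rV[Cplx R]_2) : 'rV[Cplx R]_m :=
  \row_j mpoly.meval (fun i => z 0 i) (f j).

Definition zero_locus : set 'rV[Cplx R]_2 :=
  [set z | \prod_(j < m) polymap z 0 j = 0].

End PolynomialMapping.

Section Lojasiewicz.
Variables (R : realType) (m : nat) (F : 'rV[Cplx R]_2 -> 'rV[Cplx R]_m).

Definition loja_exponents : set R :=
  [set nu | exists A B : R, [/\ 0 < A, 0 < B &
     forall z, B < rnorm z -> A * (rnorm z) `^ nu <= rnorm (F z)]].

(* ereal_sup set0 = -oo *)
Definition loja_infty : \bar R :=
  ereal_sup [set nu%:E | nu in loja_exponents].

End Lojasiewicz.

Section LaurentAtInfinity.
Variables (R : realType).

Definition outside_disc (r : R) : set (Cplx R) := [set t | r < rnorm t].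

Variables (k : nat) (r : R) (Psi : Cplx R -> 'rV[Cplx R]_k).

(* Psi(t) = a_0 t^p + a_1 t^(p-1) + a_2 t^(p-2) + ... for |t| > r; here a_0
   may vanish. *)
Definition laurent_expansion (p : int) (a : nat -> 'rV[Cplx R]_k) : Prop :=
  forall t, outside_disc r t ->
    series (fun n => t ^ (p - n%:Z) *: a n) @ \oo --> Psi t.

Definition meromorphic_at_infinity : Prop :=
  exists p a, laurent_expansion p a.

Definition holomorphic_outside : Prop :=
  forall t, outside_disc r t -> derivable Psi t 1.

Definition is_degree (d : \bar R) : Prop :=
  (exists p a, [/\ a 0%N != 0, laurent_expansion p a & d = p%:~R%:E]) \/
  ((forall t, outside_disc r t -> Psi t = 0) /\ d = -oo%E).

(* At most one d satisfies is_degree d; the default value is only taken when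
   Psi is not the sum of such a Laurent series. *)
Definition degree : \bar R := xget +oo%E is_degree.

End LaurentAtInfinity.

Definition homeomorphism_onto (T U : topologicalType) (A : set T) (B : set U)
    (f : T -> U) : Prop :=
  [/\ set_bij A B f, {within A, continuous f} &
    exists g : U -> T,
      (forall x, A x -> g (f x) = x) /\ {within B, continuous g}].

Section Branches.
Variables (R : realType).

Definition nbhs_infinity (Y : set 'rV[Cplx R]_2) : Prop := compact (~` Y).

Definition branch_parametrization (Gamma : set 'rV[Cplx R]_2) (r : R)
    (Phi : Cplx R -> 'rV[Cplx R]_2) : Prop :=
  [/\ 0 < r,
      holomorphic_outside r Phi,
      meromorphic_at_infinity r Phi,
      homeomorphism_onto (outside_disc r) Gamma Phi &
      forall u : nat -> Cplx R, (forall n, outside_disc r (u n)) ->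
        (rnorm (Phi (u n)) @[n --> \oo] --> +oo <->
         rnorm (u n) @[n --> \oo] --> +oo)].

Definition branch_decomposition (S Y : set 'rV[Cplx R]_2) (s : nat)
    (Gamma : 'I_s -> set 'rV[Cplx R]_2) (r : 'I_s -> R)
    (Phi : 'I_s -> Cplx R -> 'rV[Cplx R]_2) : Prop :=
  [/\ (0 < s)%N,
      S `&` Y = \bigcup_i Gamma i,
      trivIset setT Gamma &
      forall i, branch_parametrization (Gamma i) (r i) (Phi i)].

End Branches.

(* Main.v *)
(* Along a branch, |Phi_i(t)| and |F(Phi_i(t))| grow like |t|^deg(Phi_i) and
   |t|^deg(F o Phi_i), so the minimum of the quotients is the exact growth
   exponent of F on S. It remains to compare F with its restriction to S. Fix a
   direction v at which no leading form of the f_j vanishes, and for a point z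
   let z0 = z + tau0 v be the point of S closest to z on the line through z
   with direction v. As every root tau of f_j(z + t v) has
   |tau0 - tau| <= 2 |tau|, one gets |f_j(z0)| <= 2^(deg f_j) |f_j(z)|. If
   |tau0 v| <= |z|/2, then |z0| and |z| are comparable and the bound on S at z0
   carries over to z; otherwise all roots are of size at least |z|/(2|v|), so
   |f_j(z)| >= c |z|^(deg f_j) for every j, which is enough because no quotient
   exceeds max_j deg f_j. *)
Require Import Defs.
From HB Require Import structures.
From mathcomp Require Import all_boot all_order all_algebra.
From mathcomp Require Import all_classical all_reals all_analysis.
From mathcomp Require Import complex.
From mathcomp Require mpoly.
From mathcomp Require Import zify ring lra.
Import Order.TTheory GRing.Theory Num.Theory.
Import numFieldNormedType.Exports.
(* Only the algebraic structures of mpoly are imported: its notations clash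
   with those of the analysis library. *)
Import (canonicals, coercions) mpoly.
Local Open Scope classical_set_scope.
Local Open Scope ring_scope.

Set Implicit Arguments.
Unset Strict Implicit.
Unset Printing Implicit Defensive.

(** * The real-valued norm *)

Section Rnorm.
Variable R : realType.

Section Normed.
Variable V : normedModType R[i].
Implicit Types v w : V.

Lemma rnormE v : (rnorm v)%:C%C = `|v|.
Proof. by rewrite /rnorm RRe_real ?normr_real. Qed.

Lemma rnorm_ge0 v : 0 <= rnorm v.
Proof. by rewrite -lecR rnormE; exact: normr_ge0. Qed.

Lemma rnorm0 : rnorm (0 : V) = 0.
Proof. by rewrite /rnorm (normr0 V). Qed.

Lemma rnorm_gt0 v : (0 < rnorm v) = (v != 0).
Proof. by rewrite -ltcR rnormE normr_gt0. Qed.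

Lemma rnormN v : rnorm (- v) = rnorm v.
Proof. by rewrite /rnorm normrN. Qed.

Lemma rnormD v w : rnorm (v + w) <= rnorm v + rnorm w.
Proof. by rewrite -lecR rmorphD /= !rnormE ler_normD. Qed.

Lemma rnormZ (a : R[i]) v : rnorm (a *: v) = rnorm (a : R[i]^o) * rnorm v.
Proof. by apply: complexI; rewrite rmorphM /= !rnormE normrZ. Qed.

Lemma cvg_rnormP (u : nat -> V) (l : V) :
  (u @ \oo --> l) <->
  (forall e : R, 0 < e -> \forall n \near \oo, rnorm (l - u n) < e).
Proof.
rewrite cvgrPdist_lt; split=> [ul e e0|ul e e0].
- have := ul e%:C%C; rewrite ltcR => /(_ e0).
  by apply: filterS => n; rewrite -rnormE ltcR.
- have eE : e = (complex.Re e)%:C%C by rewrite RRe_real ?gtr0_real.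
  have e'0 : 0 < complex.Re e by rewrite -ltcR -eE.
  by apply: filterS (ul _ e'0) => n; rewrite -rnormE -ltcR -eE.
Qed.

Lemma continuous_rnorm : continuous (@rnorm R V).
Proof.
move=> x; apply/cvgrPdist_lt => e e0.
have /cvgrPdist_lt/(_ e%:C%C) : (id @ x --> x) by [].
rewrite ltcR => /(_ e0); apply: filterS => y; rewrite -rnormE ltcR.
apply: le_lt_trans; rewrite ler_norml lerBrDr lerBlDl addrC; apply/andP; split.
  by have := rnormD (x - y) (- x); rewrite [X in rnorm X]addrAC subrr add0r !rnormN; lra.
by rewrite -{1}(subrK y x) addrC rnormD.
Qed.

Lemma compact_rnorm_le (A : set V) :
  compact A -> exists M : R, forall v, A v -> rnorm v <= M.
Proof.
move=> cA; have [|M [_ /(_ (M + 1))]] := @compact_bounded R R^o (@rnorm R V @` A).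
- apply: continuous_compact => //; exact/continuous_subspaceT/continuous_rnorm.
- move=> MA; exists (M + 1) => v Av.
  apply: le_trans (ler_norm _) _; apply: MA; first by rewrite ltrDl.
  by exists v.
Qed.

End Normed.

Lemma rnorm1 : rnorm (1 : Cplx R) = 1.
Proof. by rewrite /rnorm normr1. Qed.

Lemma rnormM (a b : Cplx R) : rnorm ((a * b) : Cplx R) = rnorm a * rnorm b.
Proof. exact: rnormZ. Qed.

Lemma rnormX (a : Cplx R) n : rnorm ((a ^+ n) : Cplx R) = rnorm a ^+ n.
Proof. by elim: n => [|n ih]; rewrite ?rnorm1// !exprS rnormM ih. Qed.

Lemma rnorm_prod (I : Type) (s : seq I) (P : pred I) (a : I -> Cplx R) :
  rnorm ((\prod_(i <- s | P i) a i) : Cplx R) = \prod_(i <- s | P i) rnorm (a i).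
Proof. exact: (big_morph (@rnorm R (Cplx R)) rnormM rnorm1). Qed.

Lemma rnormV (a : Cplx R) : rnorm ((a^-1) : Cplx R) = (rnorm a)^-1.
Proof.
by apply: complexI; rewrite rnormE fmorphV/= rnormE; exact: (@normfV R[i] a).
Qed.

Lemma rnormXz (a : Cplx R) (p : int) : rnorm ((a ^ p) : Cplx R) = rnorm a ^ p.
Proof. by case: p => n; rewrite ?NegzE -?exprnN ?exprnP ?rnormV ?rnormX. Qed.

Lemma rnorm_real (x : R) : 0 <= x -> rnorm (x%:C%C : Cplx R) = x.
Proof.
move=> x0; apply: complexI; rewrite rnormE; apply: (@ger0_norm R[i]).
by rewrite lecR.
Qed.

Lemma rnorm_sum (V : normedModType R[i]) (I : Type) (s : seq I) (P : pred I)
    (a : I -> V) :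
  rnorm (\sum_(i <- s | P i) a i) <= \sum_(i <- s | P i) rnorm (a i).
Proof.
apply: (big_ind2 (fun v x => rnorm v <= x)) => // [|x1 x2 y1 y2 h1 h2].
  by rewrite rnorm0.
by apply: le_trans (rnormD _ _) _; apply: lerD.
Qed.

Lemma rnorm_coord k (v : 'rV[Cplx R]_k) j : rnorm (v 0 j) <= rnorm v.
Proof.
rewrite -lecR !rnormE.
have -> : `|v| = (\big[Order.max/0%:nng]_(ij : 'I_1 * 'I_k) `|v ij.1 ij.2|%:nng)%:num.
  exact: mx_normE.
rewrite [_ <= _%:num]num_le.
exact: (le_bigmax _ (fun ij : 'I_1 * 'I_k => `|v ij.1 ij.2|%:nng) (0, j)).
Qed.

(** A nonzero maximum norm is attained at some entry; [0 <= M] settles the zero vector, including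
    the case [k = 0]. *)
Lemma rnorm_rV_le k (v : 'rV[Cplx R]_k) (M : R) : 0 <= M ->
  (forall j, rnorm (v 0 j) <= M) -> rnorm v <= M.
Proof.
move=> M0 h; have [->|v0] := eqVneq (rnorm v) 0; first by [].
have : mx_norm v != 0.
  by apply: contra_neq v0 => v0; rewrite /rnorm [`|v|]v0.
move=> /mx_norm_neq0[[i j]] /= vE.
by rewrite /rnorm [`|v|]vE ord1 h.
Qed.

End Rnorm.

(** * Laurent series at infinity: coefficient bounds and leading terms *)

Section Laurent.
Variable R : realType.

(* [laurent_expansion] with values in an arbitrary normed module, so that it
   also covers the coordinates. *)
Definition laurent (V : normedModType R[i]) (r : R) (g : Cplx R -> V)
    (p : int) (a : nat -> V) : Prop :=
  forall t : Cplx R, outside_disc r t ->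
    series (fun n => t ^ (p - n%:Z) *: a n) @ \oo --> g t.

Lemma sum_geometric_le (z : R) n : 0 <= z < 1 ->
  \sum_(0 <= k < n) z ^+ k <= (1 - z)^-1.
Proof.
move=> /andP[z0 z1]; have z1' : 0 < 1 - z by rewrite subr_gt0.
have E : (1 - z) * \sum_(0 <= k < n) z ^+ k = 1 - z ^+ n.
  elim: n => [|n ih]; first by rewrite big_nil expr0 mulr0 subrr.
  by rewrite big_nat_recr//= mulrDr ih exprS; ring.
by rewrite -[leRHS]mul1r ler_pdivlMr// mulrC E gerBl exprn_ge0.
Qed.

Section Values.
Variable V : normedModType R[i].
Implicit Types (u a : nat -> V) (l c : V) (g : Cplx R -> V) (t : Cplx R).

Lemma rnorm_lim_le u l c (M : R) : u @ \oo --> l ->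
  (\forall n \near \oo, rnorm (u n - c) <= M) -> rnorm (l - c) <= M.
Proof.
move=> /cvg_rnormP ul uM; apply/ler_addgt0Pr => e /ul ule.
near \oo => n.
rewrite -[l](subrK (u n)) -addrA addrC; apply: le_trans (rnormD _ _) _.
by apply: lerD; [near: n | apply/ltW; near: n].
Unshelve. all: by end_near. Qed.

Lemma cvg_series_bounded u l : series u @ \oo --> l ->
  exists2 M : R, 0 <= M & forall n, rnorm (u n) <= M.
Proof.
move=> /cvg_rnormP/(_ 1 ltr01)[N _ Nl].
pose S := \sum_(k < N) rnorm (u k).
have S0 : 0 <= S by apply: sumr_ge0 => k _; exact: rnorm_ge0.
exists (2 + S) => [|n]; first by rewrite addr_ge0.
have [nN|Nn] := ltnP n N.
  apply: (@le_trans _ _ S); last by rewrite lerDr.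
  rewrite /S (bigD1 (Ordinal nN)) //= lerDl.
  by apply: sumr_ge0 => k _; exact: rnorm_ge0.
(* A term is the difference of two consecutive remainders, each of norm below 1 from rank [N] on;
   hence the constant 2. *)
have uE : u n = (l - series u n) - (l - series u n.+1).
  by rewrite /series /= big_nat_recr//= opprB [RHS]addrC addrA subrK addrAC subrr add0r.
rewrite uE; apply: le_trans (rnormD _ _) _; rewrite rnormN.
have := Nl n Nn; have := Nl n.+1 (leqW Nn); rewrite /=; lra.
Qed.

Lemma rnorm_outside_disc_gt0 r t : 0 < r -> outside_disc r t -> 0 < rnorm t.
Proof. by move=> r0; exact: lt_trans. Qed.

(** A Cauchy estimate obtained without integrals: convergence at the single point [t = rho] bounds
    the terms of the series there. *)
Lemma laurent_coef_bound r g p a (rho : R) : 0 < r -> r < rho ->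
  laurent r g p a ->
  exists2 M : R, 0 <= M & forall n, rnorm (a n) <= M * rho ^+ n.
Proof.
move=> r0 rrho ga; have rho0 : 0 < rho by exact: lt_trans rrho.
have trho : rnorm (rho%:C%C : Cplx R) = rho by rewrite rnorm_real// ltW.
have /ga/cvg_series_bounded[M M0 Ma] : outside_disc r (rho%:C%C : Cplx R).
  by rewrite /outside_disc /= trho.
exists (M * (rho ^ p)^-1) => [|n].
  by rewrite mulr_ge0// invr_ge0 exprz_ge0// ltW.
have := Ma n; rewrite rnormZ rnormXz trho expfzDr ?gt_eqF// -exprnN.
have A0 : 0 < rho ^ p by exact: exprz_gt0.
have X0 : 0 < rho ^+ n by exact: exprn_gt0.
rewrite -mulrA -ler_pdivrMr ?mulr_gt0 ?invr_gt0//; congr (_ <= _).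
by field; rewrite !gt_eqF.
Qed.

(** For [|t| >= 2 rho] the terms after the first are dominated by a geometric series of ratio
    [rho / |t| <= 1/2], whose sum is at most 2. *)
Lemma laurent_asymptotics r g p a : 0 < r -> laurent r g p a ->
  exists K T : R, [/\ 0 <= K, r < T &
    forall t, T <= rnorm t -> rnorm (g t - t ^ p *: a 0%N) <= K * rnorm t ^ (p - 1)].
Proof.
move=> r0 ga; pose rho := r + 1.
have rrho : r < rho by rewrite ltrDl.
have rho0 : 0 < rho by exact: lt_trans rrho.
have [M M0 Ma] := laurent_coef_bound r0 rrho ga.
exists (M * rho * 2), (2 * rho); split; [by rewrite !mulr_ge0// ltW|lra|] => t tT.
have t0 : 0 < rnorm t by apply: lt_le_trans tT; rewrite mulr_gt0.
have /ga gt : outside_disc r t by rewrite /outside_disc /=; lra.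
apply: (rnorm_lim_le gt); near=> n.
have n0 : (0 < n)%N by near: n; exists 1%N.
rewrite /series /= -(prednK n0) big_nat_recl// subr0 addrAC subrr add0r.
apply: le_trans (rnorm_sum _ _ _) _.
pose z := rho / rnorm t.
have z0 : 0 <= z by rewrite divr_ge0// ltW.
have z12 : z <= 2^-1 by rewrite ler_pdivrMr// ler_pdivlMl.
apply: (@le_trans _ _ (\sum_(0 <= i < n.-1) M * rho * rnorm t ^ (p - 1) * (2^-1) ^+ i)).
  apply: ler_sum_nat => k _; rewrite rnormZ rnormXz.
  apply: (@le_trans _ _ (rnorm t ^ (p - k.+1%:Z) * (M * rho ^+ k.+1))).
    by rewrite ler_wpM2l// exprz_ge0// ltW.
  rewrite (_ : p - k.+1%:Z = p - 1 - k%:Z); last by rewrite -addn1 PoszD; ring.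
  rewrite expfzDr ?gt_eqF// -exprnN.
  rewrite [leLHS](_ : _ = M * rho * rnorm t ^ (p - 1) * z ^+ k).
    by rewrite ler_wpM2l ?mulr_ge0 ?exprz_ge0 ?(ltW t0) ?(ltW rho0)//
      lerXn2r ?nnegrE// invr_ge0.
  by rewrite /z expr_div_n exprS; field; rewrite expf_neq0// gt_eqF.
rewrite -mulr_sumr [leRHS]mulrAC; apply: ler_wpM2l.
  by rewrite !mulr_ge0 ?exprz_ge0// ltW.
by apply: le_trans (sum_geometric_le _ _) _; [lra|rewrite [leLHS](_ : _ = 2)//; field].
Unshelve. all: by end_near. Qed.

(** With [A] the norm of the leading coefficient, the remainder [K |t|^(p-1)] is at most half of
    [A |t|^p] as soon as [|t| >= 2 K / A]. *)
Lemma laurent_equivalent r g p a : 0 < r -> laurent r g p a -> a 0%N != 0 ->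
  exists c C T : R, [/\ 0 < c, 0 < C, r < T & forall t, T <= rnorm t ->
    c * rnorm t ^ p <= rnorm (g t) <= C * rnorm t ^ p].
Proof.
move=> r0 /(laurent_asymptotics r0)[K [T [K0 rT gK]]]; rewrite -rnorm_gt0.
set A := rnorm (a 0%N) => A0.
exists (A / 2), (A + A / 2), (Num.max T (2 * K / A)); split; [lra|lra|by rewrite lt_max rT|].
move=> t; rewrite ge_max => /andP[Tt Kt].
have t0 : 0 < rnorm t by apply: lt_le_trans Tt; exact: lt_trans rT.
have tp : 0 < rnorm t ^ p by exact: exprz_gt0.
have {}gK : rnorm (g t - t ^ p *: a 0%N) <= A / 2 * rnorm t ^ p.
  apply: le_trans (gK t Tt) _; rewrite expfzDr ?gt_eqF// mulrCA mulrC.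
  rewrite ler_wpM2r ?(ltW tp)// ler_pdivrMr//.
  by move: Kt; rewrite ler_pdivrMr//; lra.
have h : rnorm (t ^ p *: a 0%N) = A * rnorm t ^ p by rewrite rnormZ rnormXz mulrC.
have h1 := rnormD (g t - t ^ p *: a 0%N) (t ^ p *: a 0%N).
have h2 := rnormD (t ^ p *: a 0%N - g t) (g t).
rewrite -[in X in X <= _]rnormN in gK *.
move: h1 h2 gK; rewrite !subrK opprB h => h1 h2 gK.
move: h1; rewrite -(rnormN (g t - _)) opprB => h1.
by apply/andP; split; nra.
Qed.

End Values.

End Laurent.

(** * Sums and products of Laurent expansions *)

Section LaurentAlgebra.
Variable R : realType.
Variable r : R.

Lemma eq_cvg_seq (T : topologicalType) (u v : nat -> T) (l : T) :
  u =1 v -> u @ \oo --> l -> v @ \oo --> l.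
Proof. by move=> /funext ->. Qed.

Section Shift.
Variable V : normedModType R[i].
Implicit Types (a : nat -> V) (g : Cplx R -> V).

(** Since the first coefficient may vanish, an expansion can be rewritten with a larger exponent;
    this is how two expansions get a common one. *)
Lemma laurent_pad g p a k : laurent r g p a ->
  laurent r g (p + k%:Z) (fun n => if (n < k)%N then 0 else a (n - k)%N).
Proof.
move=> ga t rt; rewrite -(cvg_shiftn k).
apply: eq_cvg_seq (ga t rt) => n.
rewrite /series /= [RHS](@big_cat_nat _ _ _ k) ?leq_addl//=.
rewrite [X in _ = X + _]big1_seq => [|i]; last first.
  by rewrite mem_index_iota => /= ->; rewrite scaler0.
rewrite add0r (big_addn 0 _ k) addnK; apply: eq_bigr => i _.
by rewrite ltnNge leq_addl/= addnK PoszD; congr (_ ^ _ *: _); ring.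
Qed.

Lemma laurent_drop g p a k : laurent r g p a -> (forall n, (n < k)%N -> a n = 0) ->
  laurent r g (p - k%:Z) (fun n => a (n + k)%N).
Proof.
move=> ga a0 t rt; have := ga t rt; rewrite -(cvg_shiftn k).
apply: eq_cvg_seq => n.
rewrite /series /= (@big_cat_nat _ _ _ k) ?leq_addl//=.
rewrite [X in X + _]big1_seq => [|i]; last first.
  by rewrite mem_index_iota => /= /a0 ->; rewrite scaler0.
rewrite add0r (big_addn 0 _ k) addnK; apply: eq_bigr => i _.
by rewrite PoszD; congr (_ ^ _ *: _); ring.
Qed.

Definition has_laurent g := exists p a, laurent r g p a.

(** Quantifying over all large [N] lets finitely many functions share an exponent, by intersecting
    neighbourhoods of infinity. *)
Lemma has_laurent_near g : has_laurent g ->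
  \forall N \near \oo, exists a, laurent r g (N : nat)%:Z a.
Proof.
move=> [p [a ga]]; exists `|p|%N => // N /= pN.
have -> : N%:Z = p + (`|N%:Z - p|%N)%:Z by lia.
by eexists; exact: laurent_pad ga.
Qed.

Lemma has_laurent_cst (c : V) : has_laurent (fun=> c).
Proof.
exists 0, (fun n => if n is 0%N then c else 0) => t _.
rewrite -(cvg_shiftn 1); apply: cvg_near_cst; near=> n.
rewrite /series /= addn1 big_nat_recl// big1 ?addr0 => [|i _]; last by rewrite scaler0.
by rewrite expr0z scale1r.
Unshelve. all: by end_near. Qed.

Lemma has_laurentD g h : has_laurent g -> has_laurent h -> has_laurent (fun t => g t + h t).
Proof.
move=> /has_laurent_near gN /has_laurent_near hN.
have [N [[a ga] [b hb]]] := filter_ex (filterI gN hN).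
exists N%:Z, (fun n => a n + b n) => t rt.
apply: eq_cvg_seq (cvgD (ga t rt) (hb t rt)) => n.
by rewrite fctE /series /= -big_split/=; apply: eq_bigr => i _; rewrite scalerDr.
Qed.

Lemma has_laurent_sum (I : Type) (s : seq I) (g : I -> Cplx R -> V) :
  (forall i, has_laurent (g i)) -> has_laurent (fun t => \sum_(i <- s) g i t).
Proof.
move=> h; elim: s => [|i s ih].
  by under eq_fun do rewrite big_nil; exact: has_laurent_cst.
by under eq_fun do rewrite big_cons; exact: has_laurentD.
Qed.

End Shift.

Lemma triangle_sum (W : nmodType) (F : nat -> nat -> W) n :
  \sum_(0 <= k < n) \sum_(0 <= i < k.+1) F i (k - i)%N =
  \sum_(0 <= i < n) \sum_(0 <= j < n - i) F i j.
Proof.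
elim: n => [|n ih]; first by rewrite !big_nil.
rewrite big_nat_recr//= ih [RHS]big_nat_recr//= subSnn big_nat1.
rewrite [X in _ + X]big_nat_recr//= subnn addrA; congr (_ + _).
rewrite -big_split/=; apply: eq_big_nat => i /andP[_ ltin].
by rewrite subSn ?(ltnW ltin)// big_nat_recr.
Qed.

(* The terms with [i + j >= n] are bounded by [M^2 eta^n eta^i eta^j]. *)
Lemma cauchy_product (x y : nat -> Cplx R) (A B : Cplx R) (M eta : R) :
  0 <= eta < 1 -> 0 <= M ->
  (forall n, rnorm (x n) <= M * (eta ^+ n) ^+ 2) ->
  (forall n, rnorm (y n) <= M * (eta ^+ n) ^+ 2) ->
  series x @ \oo --> A -> series y @ \oo --> B ->
  series (fun n => \sum_(0 <= i < n.+1) x i * y (n - i)%N : Cplx R) @ \oo -->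
    (A * B : Cplx R).
Proof.
move=> /[dup] eta01 /andP[eta0 eta1] M0 xM yM xA yB.
have xyAB :
    (fun n => series x n * series y n : Cplx R) @ \oo --> (A * B : Cplx R).
  exact: (cvgM (f := series x) (g := series y) xA yB).
apply/cvg_rnormP => e e0.
have e20 : 0 < e / 2 by rewrite divr_gt0.
have xye := (cvg_rnormP (V := Cplx R) _ _).1 xyAB _ e20.
set G := (1 - eta)^-1.
have G0 : 0 < G by rewrite invr_gt0 subr_gt0.
(* The [+ 1] keeps the divisor positive when [M = 0]. *)
have D0 : 0 < M ^+ 2 * G ^+ 2 + 1 by rewrite ltr_wpDl// mulr_ge0// sqr_ge0.
have : (fun n => eta ^+ n) @ \oo --> (0 : R) by apply: cvg_expr; rewrite ger0_norm.
move=> /cvgrPdist_lt/(_ _ (divr_gt0 e20 D0)) etae.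
near=> n.
have h1 : rnorm (A * B - series x n * series y n : Cplx R) < e / 2.
  by near: n; exact: xye.
have h3 : `|0 - eta ^+ n| < e / 2 / (M ^+ 2 * G ^+ 2 + 1) by near: n; exact: etae.
set u := series _ n; pose v := series x n * series y n.
rewrite -[A * B](subrK v) -addrA; apply: le_lt_trans (rnormD _ _) _.
suff h2 : rnorm (v - u : Cplx R) <= M ^+ 2 * G ^+ 2 * eta ^+ n.
  move: h3; rewrite sub0r normrN ger0_norm ?exprn_ge0// ltr_pdivlMr// => h3.
  have : 0 <= eta ^+ n by rewrite exprn_ge0.
  by move: h1 h2 h3; rewrite -/v; lra.
have -> : v - u = \sum_(0 <= i < n) \sum_(n - i <= j < n) x i * y j :> Cplx R.
  rewrite /v /u /series /= (triangle_sum (fun i j => x i * y j)) mulr_suml -sumrB.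
  apply: eq_big_nat => i /andP[_ ltin]; rewrite mulr_sumr.
  by rewrite (@big_cat_nat _ _ _ (n - i)%N) ?leq_subr//= addrAC subrr add0r.
apply: le_trans (rnorm_sum _ _ _) _.
apply: (@le_trans _ _ (\sum_(0 <= i < n) \sum_(0 <= j < n)
    M ^+ 2 * eta ^+ n * eta ^+ i * eta ^+ j)).
  apply: ler_sum_nat => i /andP[_ ltin]; apply: le_trans (rnorm_sum _ _ _) _.
  rewrite [leRHS](@big_cat_nat _ _ _ (n - i)%N) ?leq_subr//=.
  apply: (@le_trans _ _ (\sum_(n - i <= j < n)
      M ^+ 2 * eta ^+ n * eta ^+ i * eta ^+ j)); last first.
    by rewrite lerDr sumr_ge0// => j _; rewrite !mulr_ge0// exprn_ge0.
  apply: ler_sum_nat => j /andP[ij _]; rewrite rnormM.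
  apply: (@le_trans _ _ (M * (eta ^+ i) ^+ 2 * (M * (eta ^+ j) ^+ 2))).
    by apply: ler_pM => //; exact: rnorm_ge0.
  rewrite [leLHS](_ : _ = M ^+ 2 * (eta ^+ (i + j)) * eta ^+ i * eta ^+ j); last first.
    by rewrite exprD; ring.
  rewrite !ler_wpM2r ?exprn_ge0// ler_wpM2l ?sqr_ge0// ler_wiXn2l// ?(ltW eta1)//.
  by rewrite -leq_subLR.
under eq_bigr do rewrite -mulr_sumr.
rewrite -mulr_suml -mulr_sumr.
have := sum_geometric_le n eta01; rewrite -/G; set S := \sum_(_ <= _ < _) _ => SG.
have S0 : 0 <= S by rewrite sumr_ge0// => j _; rewrite exprn_ge0.
rewrite -mulrA [leRHS]mulrAC ler_wpM2l//; first by rewrite mulr_ge0 ?sqr_ge0 ?exprn_ge0.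
by rewrite -expr2 lerXn2r// nnegrE// ltW.
Unshelve. all: by end_near. Qed.

Lemma has_laurentM (g h : Cplx R -> Cplx R) : 0 < r ->
  has_laurent g -> has_laurent h -> has_laurent (fun t => g t * h t : Cplx R).
Proof.
move=> r0 [p [a ga]] [q [b hb]].
exists (p + q), (fun n => \sum_(0 <= i < n.+1) a i * b (n - i)%N) => t rt.
have t0 := rnorm_outside_disc_gt0 r0 rt.
(* [rho > r] gives the coefficient bounds, and [rho < |t|] makes [eta < 1]. The square root in [eta]
   matches [cauchy_product], where the terms decay like [eta^(2n)]. *)
pose rho := (r + rnorm t) / 2.
have rrho : r < rho by move: rt; rewrite /outside_disc /= /rho; lra.
have rhot : rho < rnorm t by move: rt; rewrite /outside_disc /= /rho; lra.
have rho0 : 0 < rho by exact: lt_trans rrho.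
have [Ma Ma0 aM] := laurent_coef_bound r0 rrho ga.
have [Mb Mb0 bM] := laurent_coef_bound r0 rrho hb.
pose eta := Num.sqrt (rho / rnorm t).
have eta2 : eta ^+ 2 = rho / rnorm t by rewrite sqr_sqrtr// divr_ge0// ltW.
have eta1 : 0 <= eta < 1.
  rewrite sqrtr_ge0/= -(@expr_lt1 _ 2)// ?sqrtr_ge0// eta2.
  by rewrite ltr_pdivrMr// mul1r.
have bnd k c Mc n : rnorm c <= Mc * rho ^+ n ->
    rnorm ((t ^ (k - n%:Z) : R[i]) *: c : Cplx R) <= rnorm t ^ k * Mc * (eta ^+ n) ^+ 2.
  move=> cM; rewrite rnormZ rnormXz exprAC eta2 expfzDr ?gt_eqF// -exprnN.
  rewrite [leRHS](_ : _ = rnorm t ^ k * rnorm t ^- n * (Mc * rho ^+ n)); last first.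
    by rewrite expr_div_n; ring.
  by rewrite ler_wpM2l// mulr_ge0 ?invr_ge0 ?exprn_ge0 ?exprz_ge0// ltW.
pose M := rnorm t ^ p * Ma + rnorm t ^ q * Mb.
have pM : 0 <= rnorm t ^ p * Ma by rewrite mulr_ge0// exprz_ge0// ltW.
have qM : 0 <= rnorm t ^ q * Mb by rewrite mulr_ge0// exprz_ge0// ltW.
apply: eq_cvg_seq (cauchy_product eta1 (addr_ge0 pM qM) _ _ (ga t rt) (hb t rt)) => n.
- rewrite /series /=; apply: eq_bigr => k _; rewrite scaler_sumr.
  apply: eq_big_nat => i /andP[_]; rewrite ltnS => ik.
  rewrite -scalerAl -scalerAr scalerA -expfzDr; last by move: t0; rewrite rnorm_gt0.
  by congr (_ ^ _ *: _); rewrite -subzn//; ring.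
- by apply: le_trans (bnd _ _ _ _ (aM n)) _; rewrite ler_wpM2r ?sqr_ge0// lerDl.
- by apply: le_trans (bnd _ _ _ _ (bM n)) _; rewrite ler_wpM2r ?sqr_ge0// lerDr.
Qed.

End LaurentAlgebra.

(** * Vector-valued expansions, composition with polynomials, existence of the degree *)

Section LaurentMappings.
Variable R : realType.
Variable r : R.

Lemma cvg_rVP k (u : nat -> 'rV[Cplx R]_k) (l : 'rV[Cplx R]_k) :
  (u @ \oo --> l) <-> (forall j, (fun n => u n 0 j) @ \oo --> l 0 j).
Proof.
split=> [ul j|ul]; apply/cvg_rnormP => e e0.
- move/cvg_rnormP: ul => /(_ _ e0); apply: filterS => n; apply: le_lt_trans.
  by have := rnorm_coord (l - u n) j; rewrite !mxE.
- have e20 : 0 < e / 2 by rewrite divr_gt0.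
  have : \forall n \near \oo, forall j, rnorm (l 0 j - u n 0 j) < e / 2.
    by apply: filter_forall => j; have /cvg_rnormP/(_ _ e20) := ul j.
  apply: filterS => n un; apply: (@le_lt_trans _ _ (e / 2)); last by lra.
  by apply: rnorm_rV_le (ltW e20) _ => j; rewrite !mxE ltW.
Qed.

Lemma series_coord k (u : nat -> 'rV[Cplx R]_k) j n :
  series u n 0 j = series (fun n => u n 0 j) n.
Proof. by rewrite /series /= summxE. Qed.

Lemma has_laurent_coord k (g : Cplx R -> 'rV[Cplx R]_k) j :
  has_laurent r g -> has_laurent r (fun t => g t 0 j).
Proof.
move=> [p [a ga]]; exists p, (fun n => a n 0 j) => t rt.
have /cvg_rVP/(_ j) := ga t rt; apply: eq_cvg_seq => n.
by rewrite series_coord; congr (series _ n); apply/funext => i; rewrite mxE.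
Qed.

Lemma has_laurent_rV k (g : Cplx R -> 'rV[Cplx R]_k) :
  (forall j, has_laurent r (fun t => g t 0 j)) -> has_laurent r g.
Proof.
move=> gj; have : \forall N \near \oo, forall j,
    exists a, laurent r (fun t => g t 0 j) (N : nat)%:Z a.
  by apply: filter_forall => j; exact: has_laurent_near.
move=> /filter_ex[N /choice[a ga]]; exists N%:Z, (fun n => \row_j a j n) => t rt.
apply/cvg_rVP => j; apply: eq_cvg_seq (ga j t rt) => n.
by rewrite series_coord; congr (series _ n); apply/funext => i; rewrite !mxE.
Qed.

Lemma has_laurentX (g : Cplx R -> Cplx R) n : 0 < r ->
  has_laurent r g -> has_laurent r (fun t => g t ^+ n : Cplx R).
Proof.
move=> r0 hg; elim: n => [|n ih].
  by under eq_fun do rewrite expr0; exact: has_laurent_cst.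
by under eq_fun do rewrite exprS; exact: (has_laurentM r0 hg ih).
Qed.

Lemma has_laurent_prod (I : Type) (s : seq I) (g : I -> Cplx R -> Cplx R) : 0 < r ->
  (forall i, has_laurent r (g i)) -> has_laurent r (fun t => \prod_(i <- s) g i t : Cplx R).
Proof.
move=> r0 hg; elim: s => [|i s ih].
  by under eq_fun do rewrite big_nil; exact: has_laurent_cst.
by under eq_fun do rewrite big_cons; exact: (has_laurentM r0 (hg i) ih).
Qed.

Lemma has_laurent_polymap m (f : 'I_m -> mpoly.mpoly 2 R[i]) (g : Cplx R -> 'rV[Cplx R]_2) :
  0 < r -> has_laurent r g -> has_laurent r (polymap f \o g).
Proof.
move=> r0 hg; apply: has_laurent_rV => j.
under eq_fun do rewrite /= mxE mpoly.mevalE.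
apply: has_laurent_sum => mon.
have h := has_laurent_prod (index_enum 'I_2) r0
  (fun i => has_laurentX (mpoly.fun_of_multinom mon i) r0 (has_laurent_coord i hg)).
exact: (has_laurentM r0 (has_laurent_cst r _) h).
Qed.

(** [degree] chooses a value satisfying [is_degree], so existence has to be shown: drop the
    coefficients before the first nonzero one, or take [-oo] if all of them vanish. *)
Lemma is_degree_degree k (g : Cplx R -> 'rV[Cplx R]_k) :
  has_laurent r g -> is_degree r g (degree r g).
Proof.
move=> [p [a ga]].
suff : exists d, is_degree r g d by move=> [d gd]; exact: (xgetPex +oo%E (ex_intro _ d gd)).
have [[n an]|a0] := pselect (exists n, a n != 0); last first.
  exists -oo%E; right; split=> // t rt; have := ga t rt.
  have -> : series (fun n => t ^ (p - n%:Z) *: a n) = fun=> 0.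
    apply/funext => n; rewrite /series /= big1// => i _.
    have [->|ai] := eqVneq (a i) 0; first by rewrite scaler0.
    by exfalso; apply: a0; exists i.
  move=> g0; apply: (cvg_unique _ g0); [exact: norm_hausdorff|exact: cvg_cst].
have [k' ak' kmin] := ex_minnP (ex_intro (fun n => a n != 0) n an).
exists (p - k'%:Z)%:~R%:E; left; exists (p - k'%:Z), (fun n => a (n + k')%N).
split; [exact: ak'| |by []].
apply: laurent_drop ga _ => i ik; apply/eqP/negPn/negP => /kmin.
by rewrite leqNgt ik.
Qed.

End LaurentMappings.

(** * Restriction of a polynomial to a line *)

(** The monomial order refines the degree, so this is the total degree, with value 0 at [f = 0]. *)
Definition tdeg n (K : nzRingType) (f : mpoly.mpoly n K) : nat :=
  mpoly.mdeg (mpoly.mlead f).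

Lemma mdeg_le_tdeg n (K : nzRingType) (f : mpoly.mpoly n K) (mu : mpoly.multinom n) :
  mu \in mpoly.msupp f -> (mpoly.mdeg mu <= tdeg f)%N.
Proof.
move=> muf; rewrite -ltnS mpoly.mlead_deg; first exact: mpoly.msize_mdeg_lt.
by apply: contraTneq muf => ->; rewrite -mpoly.mcoeff_eq0 mpoly.mcoeff0.
Qed.

Section Lines.
Variable K : comNzRingType.
Implicit Types (p q : {poly K}) (a b : K).

(** [n] only bounds the degree and [a] may vanish, which makes the notion multiplicative without
    case distinctions. *)
Definition top_coef p n a := (size p <= n.+1)%N /\ p`_n = a.

Lemma top_coefM p q m n a b :
  top_coef p m a -> top_coef q n b -> top_coef (p * q) (m + n) (a * b).
Proof.
move=> [sp <-] [sq <-]; split.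
  apply: leq_trans (size_polyMleq _ _) _; lia.
have im : (m < (m + n).+1)%N by rewrite ltnS leq_addr.
rewrite coefM (bigD1 (Ordinal im)) //= addKn big1 ?addr0// => i im'.
have [lt_im|le_mi] := ltnP i m.
  by rewrite [q`__]nth_default ?mulr0//; apply: leq_trans sq _; lia.
have {}im' : (i != m :> nat) by apply: contra im' => /eqP E; apply/eqP/val_inj.
by rewrite nth_default ?mul0r//; apply: leq_trans sp _; lia.
Qed.

Lemma top_coef1 : top_coef 1 0 1.
Proof. by rewrite /top_coef size_poly1 coef1. Qed.

Lemma top_coefX p m a n : top_coef p m a -> top_coef (p ^+ n) (m * n) (a ^+ n).
Proof.
move=> h; elim: n => [|n ih]; first by rewrite muln0; exact: top_coef1.
by rewrite !exprS mulnS; exact: top_coefM.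
Qed.

Lemma top_coef_linear a b : top_coef (a%:P + b *: 'X) 1 b.
Proof.
split; last by rewrite coefD coefC coefZ coefX/= add0r mulr1.
by rewrite -mul_polyC addrC size_MXaddC; case: ifP => // _; rewrite ltnS size_polyC_leq1.
Qed.

Variable n : nat.
Implicit Types (f : mpoly.mpoly n K) (z v : 'I_n -> K).

Definition line_poly f z v : {poly K} :=
  \sum_(mu <- mpoly.msupp f) mpoly.mcoeff mu f *:
    \prod_i ((z i)%:P + v i *: 'X) ^+ mpoly.fun_of_multinom mu i.

Lemma horner_line_poly f z v t :
  (line_poly f z v).[t] = mpoly.meval (fun i => z i + t * v i) f.
Proof.
rewrite /line_poly horner_sum mpoly.mevalE; apply: eq_bigr => mu _.
rewrite hornerZ horner_prod; congr (_ * _); apply: eq_bigr => i _.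
by rewrite horner_exp hornerD hornerC hornerZ hornerX mulrC.
Qed.

(** The value at [v] of the homogeneous part of highest degree. *)
Definition top_form f v : K :=
  \sum_(mu <- mpoly.msupp f | mpoly.mdeg mu == tdeg f)
    mpoly.mcoeff mu f * \prod_i v i ^+ mpoly.fun_of_multinom mu i.

(** A factor [z i + v i X] contributes only [v i] to the top coefficient, and monomials of degree
    below [tdeg f] contribute nothing; so this coefficient does not depend on [z]. *)
Lemma top_coef_line_poly f z v :
  top_coef (line_poly f z v) (tdeg f) (top_form f v).
Proof.
have mono (mu : mpoly.multinom n) :
    top_coef (\prod_i ((z i)%:P + v i *: 'X) ^+ mpoly.fun_of_multinom mu i)
      (mpoly.mdeg mu) (\prod_i v i ^+ mpoly.fun_of_multinom mu i).
  rewrite mpoly.mdegE; apply: (big_rec3 (fun p k c => top_coef p k c)).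
    exact: top_coef1.
  move=> i p k c _; apply: top_coefM.
  by have := top_coefX (mpoly.fun_of_multinom mu i) (top_coef_linear (z i) (v i));
    rewrite mul1n.
split.
  rewrite /line_poly big_seq; apply: (big_ind (fun p => (size p <= _)%N)).
  - by rewrite size_poly0.
  - by move=> p q hp hq; apply: leq_trans (size_polyD _ _) _; rewrite geq_max hp.
  - move=> mu /mdeg_le_tdeg h; apply: leq_trans (size_scale_leq _ _) _.
    by apply: leq_trans (mono mu).1 _.
rewrite /line_poly /top_form coef_sum [RHS]big_mkcond /= big_seq [RHS]big_seq.
apply: eq_bigr => mu /mdeg_le_tdeg h; rewrite coefZ.
case: eqP => [<-|hn]; first by rewrite (mono mu).2.
by rewrite nth_default ?mulr0//; apply: leq_trans (mono mu).1 _; lia.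
Qed.

End Lines.

(** The one-parameter family [(1, lambda)] turns each leading form into a univariate polynomial in
    [lambda]. *)
Definition direction (K : comNzRingType) (lambda : K) : 'I_2 -> K :=
  fun i => if i == 0 then 1 else lambda.

Lemma ord01 : lift ord0 ord0 = 1 :> 'I_2.
Proof. exact/val_inj. Qed.

(** Among monomials of the same degree in two variables, the exponent of the second variable
    determines the monomial; hence setting the first variable to 1 causes no cancellation. *)
Lemma top_form_poly (K : comNzRingType) (f : mpoly.mpoly 2 K) : f != 0 ->
  exists2 h : {poly K}, h != 0 & forall lambda, top_form f (direction lambda) = h.[lambda].
Proof.
move=> f0; pose D (mu : mpoly.multinom 2) := mpoly.mdeg mu == tdeg f.
pose h : {poly K} := \sum_(mu <- mpoly.msupp f | D mu)
  mpoly.mcoeff mu f *: 'X^(mpoly.fun_of_multinom mu 1).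
exists h => [|lambda]; last first.
  rewrite /h /top_form horner_sum; apply: eq_bigr => mu _.
  by rewrite hornerZ hornerXn big_ord_recl big_ord1 /direction /= expr1n mul1r ord01.
pose mu0 := mpoly.mlead f.
have mu0f : mu0 \in mpoly.msupp f by exact: mpoly.mlead_supp.
have Dmu0 : D mu0 by rewrite /D.
apply: contraTneq mu0f => h0; rewrite -mpoly.mcoeff_eq0.
(* Only [mu0] contributes to this coefficient of [h], which is thus the coefficient of [mu0] in
   [f]. *)
have : h`_(mpoly.fun_of_multinom mu0 1) = 0 by rewrite h0 coef0.
rewrite /h coef_sum big_mkcond (bigD1_seq mu0) ?mpoly.msupp_uniq ?mpoly.mlead_supp//=.
rewrite Dmu0 coefZ coefXn eqxx mulr1 big1 ?addr0 => [/eqP//|mu mu_neq].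
case: ifP => // Dmu; rewrite coefZ coefXn; case: eqP => [E|]; last by rewrite mulr0.
case/eqP: mu_neq; apply/mpoly.mnmP.
have := eqP Dmu; rewrite -(eqP Dmu0) !mpoly.mdegE !big_ord_recl !big_ord0 !addn0.
rewrite ord01 -E => /addIn E0 i; have [i0|i1] : i = ord0 \/ i = 1.
- by case: i => -[|[|//]] ?; [left|right]; apply/val_inj.
- by rewrite i0.
- by rewrite i1 E.
Qed.

(** * Growth of a polynomial and its factorization along lines *)

Section Growth.
Variable R : realType.

Lemma rnorm_meval_le n (f : mpoly.mpoly n R[i]) :
  exists2 C : R, 0 <= C & forall (z : 'I_n -> Cplx R) (M : R), 1 <= M ->
    (forall i, rnorm (z i) <= M) ->
    rnorm (mpoly.meval z f : Cplx R) <= C * M ^+ tdeg f.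
Proof.
exists (\sum_(mu <- mpoly.msupp f) rnorm (mpoly.mcoeff mu f : Cplx R)).
  by apply: sumr_ge0 => mu _; exact: rnorm_ge0.
move=> z M M1 zM; rewrite mpoly.mevalE; apply: le_trans (rnorm_sum _ _ _) _.
rewrite mulr_suml big_seq [leRHS]big_seq; apply: ler_sum => mu /mdeg_le_tdeg muf.
rewrite rnormM ler_wpM2l ?rnorm_ge0// rnorm_prod.
apply: (@le_trans _ _ (M ^+ mpoly.mdeg mu)); last first.
  by rewrite ler_weXn2l.
rewrite mpoly.mdegE -prodrXr; apply: ler_prod => i _.
rewrite rnorm_ge0 rnormX lerXn2r ?nnegrE ?rnorm_ge0// (le_trans _ M1)//.
Qed.

(** As the leading form does not vanish at the direction, the restriction to the line has degree
    exactly [tdeg f] for every [z], and it splits over an algebraically closed field. *)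
Lemma line_factorization (f : mpoly.mpoly 2 R[i]) (lambda : R[i]) (z : 'I_2 -> Cplx R) :
  top_form f (direction lambda) != 0 ->
  exists2 s : seq (Cplx R), size s = tdeg f &
    forall t : Cplx R, mpoly.meval (fun i => z i + t * direction lambda i) f =
      top_form f (direction lambda) * \prod_(tau <- s) (t - tau).
Proof.
move=> c0; have [sp pc] := top_coef_line_poly f z (direction lambda).
set p := line_poly _ _ _ in sp pc.
have spE : size p = (tdeg f).+1.
  by apply/eqP; rewrite eqn_leq sp ltnNge; apply: contra c0 => h; rewrite -pc nth_default.
have [s ps] := closed_field_poly_normal p.
have lc : lead_coef p = top_form f (direction lambda) by rewrite lead_coefE spE.
exists s.
  apply: succn_inj; rewrite -spE ps size_scale; first by rewrite size_prod_XsubC.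
  by rewrite lc.
move=> t; rewrite -horner_line_poly -/p ps hornerZ lc horner_prod.
by congr (_ * _); apply: eq_bigr => tau _; rewrite hornerXsubC.
Qed.

End Growth.

(** * Comparison of real powers *)

Section RealPowers.
Variable R : realType.
Implicit Types x y a b c d nu : R.

(** The constant [a^nu + b^nu] covers both signs of [nu]: the upper bound on [y] serves for
    [nu >= 0], the lower one for [nu < 0]. *)
Lemma powR_comparable a b nu : 0 < a -> 0 < b -> exists2 C, 0 < C &
  forall x y, 0 < x -> a * x <= y <= b * x -> y `^ nu <= C * x `^ nu.
Proof.
move=> a0 b0; exists (a `^ nu + b `^ nu) => [|x y x0 /andP[axy ybx]].
  by rewrite addr_gt0// powR_gt0.
have y0 : 0 < y by apply: lt_le_trans axy; rewrite mulr_gt0.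
rewrite mulrDl -!powRM ?(ltW a0) ?(ltW b0) ?(ltW x0)//; have [nu0|nu0] := leP 0 nu.
  apply: (@le_trans _ _ ((b * x) `^ nu)); last by rewrite lerDr powR_ge0.
  by rewrite ge0_ler_powR// nnegrE ?ltW// mulr_gt0.
apply: (@le_trans _ _ ((a * x) `^ nu)); last by rewrite lerDl powR_ge0.
rewrite -[nu]opprK !(powRN _ (- nu)) lef_pV2 ?posrE ?powR_gt0 ?mulr_gt0//.
by rewrite ge0_ler_powR// ?nnegrE ?ltW// ?mulr_gt0// oppr_gt0.
Qed.

Lemma powR_unbounded d b : 0 < d -> exists2 T, 0 < T & forall x, T <= x -> b <= x `^ d.
Proof.
move=> d0; exists ((`|b| + 1) `^ d^-1) => [|x Tx].
  by rewrite powR_gt0// ltr_wpDl.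
apply: (@le_trans _ _ (`|b| + 1)); first by rewrite (le_trans (ler_norm b))// lerDl.
have b1 : 0 <= `|b| + 1 by rewrite addr_ge0.
rewrite -[leLHS](powRr1 b1) -[X in _ `^ X <= _](mulVf (lt0r_neq0 d0)) powRrM.
have x0 : 0 <= x by apply: le_trans Tx; exact: powR_ge0.
by apply: ge0_ler_powR => //; rewrite ?nnegrE ?powR_ge0// ltW.
Qed.

(** If [b < a], then [x^(a-b)] exceeds [K] for large [x]. *)
Lemma powR_le_exponent a b K T :
  (forall x, T <= x -> x `^ a <= K * x `^ b) -> a <= b.
Proof.
move=> h; rewrite leNgt; apply/negP => ba.
have [T' T'0 hT'] := @powR_unbounded (a - b) (K + 1) (ltac:(by rewrite subr_gt0)).
pose x := Num.max T T'.
have x0 : 0 < x by rewrite lt_max T'0 orbT.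
have h1 := hT' x; have := h x; rewrite -{1}(subrK b a) powRD ?(gt_eqF x0) ?implybT//.
rewrite !le_max !lexx ?orbT in h1 * => /(_ isT); have {}h1 := h1 isT.
by rewrite ler_pM2r ?powR_gt0//; lra.
Qed.

End RealPowers.

(** * Transfer of bounds from the zero locus to the plane *)

Section Transfer.
Variable R : realType.

Lemma prodr_const_seq (I : Type) (s : seq I) (x : R) : \prod_(i <- s) x = x ^+ size s.
Proof. by rewrite big_const_seq count_predT iter_mulr_1. Qed.

Lemma seq_argmin (T : eqType) (s : seq T) (F : T -> R) x0 : x0 \in s ->
  exists2 x, x \in s & forall y, y \in s -> F x <= F y.
Proof.
elim: s x0 => [//|x [|y s] ih] x0 _.
  by exists x; rewrite ?mem_head// => y; rewrite inE => /eqP ->.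
have [z zs zmin] := ih y (mem_head _ _).
have [xz|zx] := leP (F x) (F z).
  exists x; first exact: mem_head.
  by move=> w; rewrite inE => /predU1P[->//|/zmin]; exact: le_trans.
exists z; first by rewrite inE zs orbT.
by move=> w; rewrite inE => /predU1P[->|/zmin//]; exact: ltW.
Qed.

Lemma rnorm_polymap_le m (f : 'I_m -> mpoly.mpoly 2 R[i]) :
  exists2 C : R, 0 <= C & forall z : 'rV[Cplx R]_2, 1 <= rnorm z ->
    rnorm (polymap f z) <= C * rnorm z ^+ (\max_j tdeg (f j)).
Proof.
have /choice[C CP] j : exists C : R, 0 <= C /\ forall z : 'rV[Cplx R]_2, 1 <= rnorm z ->
    rnorm (polymap f z 0 j) <= C * rnorm z ^+ tdeg (f j).
  have [C C0 hC] := rnorm_meval_le (f j).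
  exists C; split=> // z z1; rewrite mxE; apply: hC => // i.
  exact: rnorm_coord.
have C0 : 0 <= \sum_j C j by apply: sumr_ge0 => j _; exact: (CP j).1.
exists (\sum_j C j) => // z z1; have z0 : 0 <= rnorm z by exact: rnorm_ge0.
apply: rnorm_rV_le => [|j]; first by rewrite mulr_ge0// exprn_ge0.
apply: le_trans ((CP j).2 z z1) _; apply: ler_pM => //.
- exact: (CP j).1.
- by rewrite exprn_ge0.
- by rewrite (bigD1 j)//= lerDl; apply: sumr_ge0 => i _; exact: (CP i).1.
- by rewrite ler_weXn2l//; exact: leq_bigmax.
Qed.

(** The leading forms are nonzero polynomials in [lambda]; so is their product, and some [lambda] is
    not a root of it. *)
Lemma common_direction m (f : 'I_m -> mpoly.mpoly 2 R[i]) : (forall j, f j != 0) ->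
  exists lambda : R[i], forall j, top_form (f j) (direction lambda) != 0.
Proof.
move=> f0; have /choice[h hP] j : exists h : {poly R[i]}, h != 0 /\
    forall lambda, top_form (f j) (direction lambda) = h.[lambda].
  by have [h h0 hE] := top_form_poly (f0 j); exists h.
have : \prod_j h j != 0 by apply/prodf_neq0 => j _; exact: (hP j).1.
move=> /closed_nonrootP[lambda]; rewrite /root horner_prod => /prodf_neq0 hl.
by exists lambda => j; rewrite (hP j).2 hl.
Qed.

(* With [z0 = z + tau0 v] the zero of [f_1 ... f_m] closest to [z] on the line
   through [z] with direction [v], every root [tau] of [f_j (z + t v)] satisfies
   [|tau0 - tau| <= 2 |tau|], whence [|F z0| <= 2^D |F z|]. *)
Lemma loja_from_zero_locus m (f : 'I_m -> mpoly.mpoly 2 R[i]) (nu K : R) :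
  (forall j, f j != 0) -> zero_locus f !=set0 ->
  nu <= (\max_j tdeg (f j))%:R -> 0 <= K ->
  (forall z, zero_locus f z -> K < rnorm z -> rnorm z `^ nu <= K * rnorm (polymap f z)) ->
  loja_exponents (polymap f) nu.
Proof.
move=> f0 [zS zSP] nuD K0 hS; set D := \max_j _ in nuD.
have [lambda hl] := common_direction f0.
pose v : 'rV[Cplx R]_2 := \row_i direction lambda i.
have v1 : 1 <= rnorm v.
  by apply: le_trans (rnorm_coord v 0); rewrite mxE /direction eqxx rnorm1.
have v0 : 0 < rnorm v by exact: lt_le_trans v1.
have factor z : exists s : 'I_m -> seq (Cplx R), forall j, size (s j) = tdeg (f j) /\
    forall t : Cplx R, polymap f (z + t *: v) 0 j =
      top_form (f j) (direction lambda) * \prod_(tau <- s j) (t - tau).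
  suff /choice[s] : forall j, exists s : seq (Cplx R), size s = tdeg (f j) /\
    forall t : Cplx R, polymap f (z + t *: v) 0 j =
      top_form (f j) (direction lambda) * \prod_(tau <- s) (t - tau) by exists s.
  move=> j; have [s ss sE] := line_factorization (z 0) (hl j); exists s; split=> // t.
  by rewrite mxE -sE; apply: mpoly.meval_eq => i; rewrite !mxE.
(* [m > 0], since an empty product is 1 and has no zero; hence the maximal degree is attained. *)
have [j0 j0D] : exists j0, tdeg (f j0) = D.
  have [j _] : exists j : 'I_m, true.
    move: zSP; rewrite /zero_locus /= => /eqP/prodf_eq0[j _ _]; by exists j.
  have m0 : (0 < #|'I_m|)%N by apply/card_gt0P; exists j.
  have [i iE] := bigop.eq_bigmax (fun j => tdeg (f j)) m0.
  by exists i.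
(* A zero [zS] of [f_j] gives a root on the line through [zS], so [f_j] is not constant. This makes
   [s j0] nonempty below. *)
have D0 : (0 < D)%N.
  move: (zSP) => /eqP/prodf_eq0[j _]; have [s /(_ j)[ss sE]] := factor zS.
  have := sE 0; rewrite scale0r addr0 => ->; rewrite mulf_eq0 (negPf (hl j))/=.
  move=> sj; apply: leq_trans (leq_bigmax j); rewrite -ss lt0n size_eq0.
  by apply: contraTneq sj => ->; rewrite big_nil oner_eq0.
(* The constants come from [|z|/2 <= |z1| <= 3|z|/2], where [z1] is the nearby zero constructed
   below. *)
have [C C0 hC] := @powR_comparable R (2 / 3) 2 nu (ltac:(lra)) (ltac:(lra)).
pose c := rnorm (top_form (f j0) (direction lambda) : Cplx R).
have c0 : 0 < c by rewrite rnorm_gt0.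
(* The first summand serves when the closest zero is near [z], the second when it is far. *)
pose K' := C * (K * 2 ^+ D) + (2 * rnorm v) ^+ D / c.
have K'0 : 0 < K'.
  rewrite /K' ltr_wpDl// ?mulr_ge0 ?exprn_ge0 ?(ltW C0)//.
  by rewrite divr_gt0// exprn_gt0// mulr_gt0.
(* Beyond [2 K + 1] one has [|z| > 1] and [|z| / 2 > K]; the latter makes [hS] applicable at
   [z1]. *)
exists K'^-1, (2 * K + 1); split; [by rewrite invr_gt0|lra|move=> z Kz].
rewrite ler_pdivrMl//.
have z0 : 0 < rnorm z by lra.
have zK : K < rnorm z / 2 by lra.
have [s sP] := factor z.
have fz j : rnorm (polymap f z 0 j) =
    rnorm (top_form (f j) (direction lambda) : Cplx R) * \prod_(tau <- s j) rnorm tau.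
  have := (sP j).2 0; rewrite scale0r addr0 => ->.
  rewrite rnormM rnorm_prod; congr (_ * _).
  by apply: eq_bigr => tau _; rewrite sub0r rnormN.
pose ss := flatten [seq s j | j <- enum 'I_m].
have in_ss j tau : tau \in s j -> tau \in ss.
  by move=> h; apply/flatten_mapP; exists j; rewrite ?mem_enum.
have [tau0 tau0ss tau0min] : exists2 tau0, tau0 \in ss &
    forall tau, tau \in ss -> rnorm tau0 <= rnorm tau.
  apply: (@seq_argmin _ ss (@rnorm R (Cplx R)) (head 0 (s j0))); apply: (in_ss j0).
  by rewrite -nth0 mem_nth// (sP j0).1 j0D.
(* In the far case the component [f_j0] of highest degree suffices: its [D] roots all have modulus
   above [|z| / (2 |v|)], and [|z|^nu <= |z|^D]. *)
have [near_z|far_z] := leP (rnorm tau0 * rnorm v) (rnorm z / 2); last first.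
  apply: (@le_trans _ _ ((2 * rnorm v) ^+ D / c * rnorm (polymap f z))); last first.
    by rewrite ler_wpM2r ?rnorm_ge0// lerDr !mulr_ge0 ?exprn_ge0// ltW.
  apply: (@le_trans _ _ ((2 * rnorm v) ^+ D / c * rnorm (polymap f z 0 j0))); last first.
    by rewrite ler_wpM2l ?rnorm_coord// divr_ge0 ?exprn_ge0 ?mulr_ge0// ltW.
  apply: (@le_trans _ _ (rnorm z ^+ D)).
    by rewrite -powR_mulrn ?(ltW z0)// ler_powR//; lra.
  rewrite fz -/c mulrA divfK ?gt_eqF//.
  have -> : rnorm z ^+ D = (2 * rnorm v) ^+ D * (rnorm z / (2 * rnorm v)) ^+ D.
    by rewrite -exprMn mulrCA divff ?mulr1// mulf_neq0 ?gt_eqF.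
  rewrite ler_wpM2l ?exprn_ge0 ?mulr_ge0 ?(ltW v0)//.
  rewrite -j0D -(sP j0).1 -prodr_const_seq big_seq [leRHS]big_seq.
  apply: ler_prod => tau /in_ss/tau0min h; apply/andP; split.
    by rewrite divr_ge0 ?mulr_ge0// ltW.
  apply: le_trans (ltW _) h.
  by rewrite ltr_pdivrMr ?mulr_gt0//; lra.
pose z1 := z + tau0 *: v.
have z1S : zero_locus f z1.
  have /flatten_mapP[j _ tau0j] := tau0ss.
  apply/eqP/prodf_eq0; exists j => //; rewrite (sP j).2.
  by rewrite (big_rem tau0)//= subrr mul0r mulr0.
have Fz1 : rnorm (polymap f z1) <= 2 ^+ D * rnorm (polymap f z).
  apply: rnorm_rV_le => [|j]; first by rewrite mulr_ge0 ?exprn_ge0 ?rnorm_ge0.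
  apply: (@le_trans _ _ (2 ^+ tdeg (f j) * rnorm (polymap f z 0 j))); last first.
    apply: ler_pM; rewrite ?exprn_ge0 ?rnorm_ge0 ?rnorm_coord// ler_weXn2l ?ler1n//.
    exact: (leq_bigmax j).
  rewrite (sP j).2 fz rnormM rnorm_prod mulrCA ler_wpM2l ?rnorm_ge0//.
  rewrite -(sP j).1 -prodr_const_seq -big_split/= big_seq [leRHS]big_seq.
  apply: ler_prod => tau /in_ss/tau0min h; rewrite rnorm_ge0/=.
  by apply: le_trans (rnormD _ _) _; rewrite rnormN; lra.
have [z1z zz1] : rnorm z / 2 <= rnorm z1 /\ 2 / 3 * rnorm z1 <= rnorm z <= 2 * rnorm z1.
  have h1 := rnormD z (tau0 *: v); have h2 := rnormD z1 (- (tau0 *: v)).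
  have : rnorm (tau0 *: v) <= rnorm z / 2 by rewrite rnormZ.
  move: h1 h2; rewrite -/z1 rnormN [z1 - _]addrK.
  by move: (rnorm z) (rnorm z1) (rnorm (tau0 *: v)) => a b e; clear; lra.
have z10 : 0 < rnorm z1 by apply: lt_le_trans z1z; rewrite divr_gt0.
apply: le_trans (hC (rnorm z1) (rnorm z) z10 zz1) _.
apply: (@le_trans _ _ (C * (K * 2 ^+ D) * rnorm (polymap f z))); last first.
  by rewrite ler_wpM2r ?rnorm_ge0// lerDl divr_ge0 ?exprn_ge0 ?mulr_ge0// ltW.
rewrite -mulrA ler_wpM2l ?(ltW C0)//; apply: le_trans (hS _ z1S (lt_le_trans zK z1z)) _.
by rewrite -mulrA ler_wpM2l.
Qed.

End Transfer.

(** * Orders of growth in the parameter *)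

Section Growth.
Variable R : realType.

Definition grows k (g : Cplx R -> 'rV[Cplx R]_k) (d : R) := exists c C T : R,
  [/\ 0 < c, 0 < C, 0 < T & forall t : Cplx R, T <= rnorm t ->
    c * rnorm t `^ d <= rnorm (g t) <= C * rnorm t `^ d].

Lemma degreeP k r (g : Cplx R -> 'rV[Cplx R]_k) : 0 < r -> has_laurent r g ->
  (exists2 p : int, degree r g = p%:~R%:E & grows g p%:~R) \/
  (degree r g = -oo%E /\ forall t, outside_disc r t -> g t = 0).
Proof.
move=> r0 /is_degree_degree [[p [a [a0 ga ->]]]|[g0 ->]]; [left|by right].
exists p => //; have [c [C [T [c0 C0 rT gT]]]] := laurent_equivalent r0 ga a0.
exists c, C, T; split=> //; first exact: lt_trans rT.
by move=> t /gT; rewrite powR_intmul ?rnorm_ge0.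
Qed.

(** For [t = x] real and large, the inequality becomes [x^(q nu) <= const x^p], which compares the
    exponents. *)
Lemma grows_le k l (g : Cplx R -> 'rV[Cplx R]_k) (h : Cplx R -> 'rV[Cplx R]_l)
    (p q nu K B : R) : grows g p -> grows h q -> 0 < q -> 0 <= K ->
  (forall t, B < rnorm (h t) -> rnorm (h t) `^ nu <= K * rnorm (g t)) -> nu <= p / q.
Proof.
move=> [c [C [T [c0 C0 T0 gT]]]] [c' [C' [T' [c'0 C'0 T'0 hT]]]] q0 K0 H.
have [T1 T10 hT1] := powR_unbounded ((B + 1) / c') q0.
have [c'V0 C'V0] : 0 < c'^-1 /\ 0 < C'^-1 by rewrite !invr_gt0.
(* The growth of [h] is read backwards: [|t|^q] lies between [|h t| / C'] and [|h t| / c']. *)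
have [D D0 hD] := powR_comparable nu C'V0 c'V0.
rewrite ler_pdivlMr//.
apply: (@powR_le_exponent R _ _ (D * (K * C)) (Num.max T (Num.max T' T1))) => x.
rewrite !ge_max => /and3P[Tx T'x T1x].
have x0 : 0 < x by exact: lt_le_trans T0 Tx.
have tx : rnorm (x%:C%C : Cplx R) = x by rewrite rnorm_real ?ltW.
have := gT x%:C%C; have := hT x%:C%C; rewrite tx => /(_ T'x) /andP[h1 h2] /(_ Tx) /andP[_ g2].
have hB : B + 1 <= rnorm (h x%:C%C).
  by apply: le_trans h1; rewrite mulrC -ler_pdivrMr// hT1.
have h0 : 0 < rnorm (h x%:C%C) by apply: lt_le_trans h1; rewrite mulr_gt0 ?powR_gt0.
rewrite mulrC powRrM; apply: le_trans (hD _ _ h0 _) _.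
  by rewrite !(mulrC _^-1) ler_pdivrMr// ler_pdivlMr// (mulrC _ C') (mulrC _ c') h1 h2.
rewrite -mulrA ler_wpM2l ?(ltW D0)//; apply: le_trans (H _ _) _; first by lra.
by rewrite -mulrA ler_wpM2l.
Qed.

(** [1 <= |h t|] permits raising the exponent [nu] to [p / q], and both [|h t|^(p/q)] and [|g t|]
    are of order [|t|^p]. *)
Lemma grows_ge k l (g : Cplx R -> 'rV[Cplx R]_k) (h : Cplx R -> 'rV[Cplx R]_l)
    (p q nu : R) : grows g p -> grows h q -> 0 < q -> nu <= p / q ->
  exists K T, forall t, T <= rnorm t -> 1 <= rnorm (h t) ->
    rnorm (h t) `^ nu <= K * rnorm (g t).
Proof.
move=> [c [C [T [c0 C0 T0 gT]]]] [c' [C' [T' [c'0 C'0 T'0 hT]]]] q0 nupq.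
have [D D0 hD] := @powR_comparable R c' C' (p / q) c'0 C'0.
exists (D / c), (Num.max T T') => t; rewrite ge_max => /andP[Tt T't] h1.
have t0 : 0 < rnorm t by exact: lt_le_trans T0 Tt.
apply: le_trans (ler_powR h1 nupq) _.
apply: le_trans (hD _ _ (powR_gt0 q t0) (hT _ T't)) _.
rewrite -powRrM (mulrC q) divfK ?gt_eqF// -mulrA ler_wpM2l ?(ltW D0)//.
by rewrite mulrC ler_pdivlMr// mulrC; have /andP[] := gT t Tt.
Qed.

End Growth.

(** * Parametrized branches *)

Section Branch.
Variables (R : realType) (Gamma : set 'rV[Cplx R]_2) (r : R) (Phi : Cplx R -> 'rV[Cplx R]_2).
Hypothesis branch : branch_parametrization Gamma r Phi.

Lemma branch_radius_gt0 : 0 < r.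
Proof. by case: branch. Qed.

(** [Phi] is unbounded along real parameters tending to infinity, which excludes [Phi = 0] and every
    degree at most 0. *)
Lemma branch_degree_gt0 : exists q : int,
  [/\ 0 < q, degree r Phi = q%:~R%:E & grows Phi q%:~R].
Proof.
have r0 := branch_radius_gt0; have [_ _ mPhi _ pr] := branch.
pose u n : Cplx R := (r + 1 + n%:R)%:C%C.
have un n : rnorm (u n) = r + 1 + n%:R by rewrite rnorm_real// !addr_ge0// ltW.
have ur n : outside_disc r (u n) by rewrite /outside_disc /= un -addrA ltrDl ltr_wpDr.
have ucvg : rnorm (u n) @[n --> \oo] --> +oo.
  apply/cvgryPge => A; near=> n; rewrite un.
  have : A <= n%:R by near: n; exact: nbhs_infty_ger.
  by lra.
have Phiu := (pr u ur).2 ucvg.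
have [[q -> Phiq]|[_ Phi0]] := degreeP r0 mPhi; last first.
  have /cvgryPge/(_ 1) := Phiu => /filter_ex[n].
  by rewrite Phi0// rnorm0 ler10.
exists q; split=> //; rewrite ltNge; apply/negP => q0.
have [c [C [T [c0 C0 T0 gT]]]] := Phiq.
have /cvgryPge/(_ (C + 1)) h1 := Phiu; have /cvgryPge/(_ T) h2 := ucvg.
have [n [h1n /gT/andP[_]]] := filter_ex (filterI h1 h2); rewrite /= => h3.
have : rnorm (u n) `^ q%:~R <= rnorm (u n) `^ 0.
  by apply: ler_powR; [rewrite un; have : 0 <= n%:R :> R by []; lra|rewrite lerz0].
rewrite powRr0 => h4; have : C * rnorm (u n) `^ q%:~R <= C * 1 by rewrite ler_wpM2l// ltW.
by lra.
Unshelve. all: by end_near. Qed.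

(** Otherwise there are points of the branch tending to infinity whose parameters keep modulus below
    [T], against properness. *)
Lemma branch_parameter_unbounded (T : R) : exists B : R, forall t,
  outside_disc r t -> B < rnorm (Phi t) -> T <= rnorm t.
Proof.
have [_ _ _ _ pr] := branch; apply: contrapT => /forallNP noB.
have /choice[u uP] (n : nat) : exists t,
    [/\ outside_disc r t, n%:R < rnorm (Phi t) & rnorm t < T].
  have /existsNP[t /not_implyP[rt /not_implyP[nt /negP]]] := noB n%:R.
  by rewrite -ltNge => tT; exists t.
have ur n : outside_disc r (u n) by case: (uP n).
have : rnorm (Phi (u n)) @[n --> \oo] --> +oo.
  apply/cvgryPge => A; near=> n; have [_ /ltW nu _] := uP n; apply: le_trans nu.
  by near: n; exact: nbhs_infty_ger.
move=> /(pr u ur).1/cvgryPge/(_ T)/filter_ex[n].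
by have [_ _ +] := uP n; rewrite ltNge => /negP.
Unshelve. all: by end_near. Qed.

(** One large [K] serves both as factor and as radius; stated near [+oo], the bound can be obtained
    with the same [K] for finitely many branches. *)
Lemma branch_lower_bound l (F : 'rV[Cplx R]_2 -> 'rV[Cplx R]_l) (p q nu : R) :
  grows (F \o Phi) p -> grows Phi q -> 0 < q -> nu <= p / q ->
  \forall K \near +oo, forall z, Gamma z -> K < rnorm z ->
    rnorm z `^ nu <= K * rnorm (F z).
Proof.
move=> FPhi Phiq q0 nupq; have [K [T KT]] := grows_ge FPhi Phiq q0 nupq.
have [B TB] := branch_parameter_unbounded T.
near=> K' => z Gz Kz; have [_ _ _ [[_ _ surj] _ _] _] := branch.
have [t rt tz] := surj z Gz; rewrite -tz in Kz *.
apply: (@le_trans _ _ (K * rnorm (F (Phi t)))); last first.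
  by rewrite ler_wpM2r ?rnorm_ge0//; near: K'; exact: nbhs_pinfty_ge (num_real _).
apply: KT; last first.
  by apply: ltW; apply: le_lt_trans Kz; near: K'; exact: nbhs_pinfty_ge (num_real _).
by apply: TB => //; apply: le_lt_trans Kz; near: K'; exact: nbhs_pinfty_ge (num_real _).
Unshelve. all: by end_near. Qed.

End Branch.

(** * Exponents and degrees of the components *)

Section Exponents.
Variables (R : realType) (m : nat) (f : 'I_m -> mpoly.mpoly 2 R[i]).

Lemma zero_locus_neqT_neq0 : zero_locus f <> setT -> forall j, f j != 0.
Proof.
move=> ST j; apply/eqP => fj0; apply: ST; apply/seteqP; split=> // z _.
by apply/eqP/prodf_eq0; exists j => //; rewrite mxE fj0 mpoly.meval0.
Qed.

Lemma loja_exponentsP nu : loja_exponents (polymap f) nu ->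
  exists K B : R, [/\ 0 <= K, 0 < B & forall z, B < rnorm z ->
    rnorm z `^ nu <= K * rnorm (polymap f z)].
Proof.
move=> [A [B [A0 B0 AB]]]; exists A^-1, B; split=> //; first by rewrite invr_ge0 ltW.
by move=> z /AB h; rewrite mulrC ler_pdivlMr// mulrC.
Qed.

(** The bound [|F z| <= C |z|^D] for [|z| >= 1], taken along [Phi], compares [|t|^p] with
    [|t|^(q D)]. *)
Lemma branch_ratio_le_degree (Phi : Cplx R -> 'rV[Cplx R]_2) (p q : R) :
  grows (polymap f \o Phi) p -> grows Phi q -> 0 < q ->
  p / q <= (\max_j tdeg (f j))%:R.
Proof.
move=> FPhi Phiq q0; have [C C0] := rnorm_polymap_le f; set D := \max_j _ => hC.
have [c [C2 [T [c0 _ T0 gT]]]] := FPhi.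
have [c' [C' [T' [c'0 C'0 T'0 hT]]]] := Phiq.
have [T1 T10 hT1] := powR_unbounded c'^-1 q0.
rewrite ler_pdivrMr//.
apply: (@powR_le_exponent R _ _ (c^-1 * (C * C' ^+ D)) (Num.max T (Num.max T' T1))) => x.
rewrite !ge_max => /and3P[Tx T'x T1x].
have x0 : 0 < x by exact: lt_le_trans T0 Tx.
have tx : rnorm (x%:C%C : Cplx R) = x by rewrite rnorm_real ?ltW.
have := gT x%:C%C; have := hT x%:C%C; rewrite tx => /(_ T'x) /andP[h1 h2] /(_ Tx) /andP[g1 _].
have z1 : 1 <= rnorm (Phi x%:C%C).
  by apply: le_trans h1; rewrite mulrC -ler_pdivrMr// div1r hT1.
rewrite -mulrA ler_pdivlMl//; apply: le_trans g1 _; apply: le_trans (hC _ z1) _.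
rewrite -mulrA ler_wpM2l// mulrC (mulrC _ q) powRrM powR_mulrn ?powR_ge0// -exprMn.
by rewrite lerXn2r ?nnegrE ?rnorm_ge0 ?mulr_ge0 ?powR_ge0 ?(ltW C'0)// mulrC.
Qed.

End Exponents.

(** * The formula for the exponent *)

Unset Implicit Arguments.

Theorem theorem2 (R : realType) (m : nat) (f : 'I_m -> mpoly.mpoly 2 R[i])
    (S_neq0 : zero_locus f <> set0) (S_neqT : zero_locus f <> setT)
    (Y : set 'rV[Cplx R]_2) (Y_nbhs : nbhs_infinity Y)
    (s : nat) (Gamma : 'I_s -> set 'rV[Cplx R]_2) (r : 'I_s -> R)
    (Phi : 'I_s -> Cplx R -> 'rV[Cplx R]_2)
    (branches : branch_decomposition (zero_locus f) Y Gamma r Phi) :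
  loja_infty (polymap f) =
  \big[Order.min/+oo%E]_(i < s)
    (degree (r i) (polymap f \o Phi i) / degree (r i) (Phi i))%E.
Proof.
have [s0 SY _ br] := branches.
pose d i := (degree (r i) (polymap f \o Phi i) / degree (r i) (Phi i))%E.
(* Each [Phi i] has a positive finite degree, so the quotient is either real or [-oo], the latter
   with [F] vanishing along the branch. *)
have dP i : exists2 q : R, 0 < q /\ grows (Phi i) q &
    (exists2 p : R, d i = (p / q)%:E & grows (polymap f \o Phi i) p) \/
    (d i = -oo%E /\ forall t, outside_disc (r i) t -> polymap f (Phi i t) = 0).
  have r0 := branch_radius_gt0 (br i); have [_ _ mPhi _ _] := br i.
  have [q [q0 dq Phiq]] := branch_degree_gt0 (br i).
  have q0' : 0 < q%:~R :> R by rewrite ltr0z.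
  exists q%:~R => //; rewrite /d dq.
  have [[p -> pP]|[-> F0]] := degreeP r0 (has_laurent_polymap f r0 mPhi); [left|right].
    by exists p%:~R => //; rewrite inver gt_eqF// -EFinM.
  by split=> //; rewrite inver gt_eqF// gt0_mulNye// lte_fin invr_gt0.
apply/eqP; rewrite eq_le; apply/andP; split.
  (* Upper bound: restricting the inequality of an exponent to a branch shows that it is at most the
     quotient of this branch. *)
  apply: le_bigmin => [|i _]; first exact: leey.
  rewrite -/(d i).
  apply: ge_ereal_sup => _ [nu /loja_exponentsP[K [B [K0 B0 KB]]] <-].
  have [q [q0 Phiq] [[p -> FPhi]|[_ F0]]] := dP i.
    by rewrite lee_fin; apply: (grows_le FPhi Phiq q0 K0) => t; exact: KB.
  (* As [F] vanishes on this branch, a point of it beyond [B] contradicts the inequality: there is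
     no exponent at all, and the supremum is [-oo]. *)
  exfalso; have [c [C [T [c0 C0 T0 gT]]]] := Phiq.
  have [T1 T10 hT1] := powR_unbounded ((B + 1) / c) q0.
  pose x := Num.max (r i + 1) (Num.max T T1).
  have [rx Tx T1x] : [/\ r i + 1 <= x, T <= x & T1 <= x].
    by rewrite /x !le_max !lexx !orbT.
  have tx : rnorm (x%:C%C : Cplx R) = x by rewrite rnorm_real// (le_trans _ Tx)// ltW.
  have := gT x%:C%C; rewrite tx => /(_ Tx)/andP[h1 _].
  have hB : B + 1 <= rnorm (Phi i x%:C%C).
    by apply: le_trans h1; rewrite mulrC -ler_pdivrMr// hT1.
  have := KB (Phi i x%:C%C); rewrite F0 ?rnorm0 ?mulr0; last first.
    by rewrite /outside_disc /= tx; lra.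
  have : 0 < rnorm (Phi i x%:C%C) `^ nu by rewrite powR_gt0//; lra.
  by move=> h /(_ (ltac:(lra))); rewrite leNgt h.
(* Lower bound: the minimum, when real, is itself an exponent. *)
rewrite -/d; set mu := \big[_/_]_(_ < _) _.
have mu_le i : (mu <= d i)%E by exact: bigmin_le.
(* [+oo] is the neutral element of the minimum; it is excluded because there is at least one branch
   and its quotient is not [+oo]. *)
case muE : mu => [nu| |]; last exact: leNye; last first.
  have := mu_le (Ordinal s0); rewrite muE.
  by have [q _ [[p -> _]|[-> _]]] := dP (Ordinal s0).
have dlow i : exists p q : R,
    [/\ 0 < q, grows (Phi i) q, grows (polymap f \o Phi i) p & nu <= p / q].
  have := mu_le i; rewrite muE; have [q [q0 Phiq] [[p -> pP]|[-> _]]] := dP i => //.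
  by rewrite lee_fin => h; exists p, q.
apply: ereal_sup_ubound; exists nu => //.
have Kbr : \forall K \near +oo, forall i z, Gamma i z -> K < rnorm z ->
    rnorm z `^ nu <= K * rnorm (polymap f z).
  apply: filter_forall => i; have [p [q [q0 Phiq FPhi h]]] := dlow i.
  exact: (branch_lower_bound (br i) FPhi Phiq q0 h).
have [M MY] := compact_rnorm_le Y_nbhs.
near (pinfty_nbhs R) => K.
apply: (@loja_from_zero_locus _ _ _ _ (K : R)).
- exact: zero_locus_neqT_neq0.
- exact/set0P/eqP.
- have [p [q [q0 Phiq FPhi h]]] := dlow (Ordinal s0).
  by apply: le_trans h _; exact: branch_ratio_le_degree FPhi Phiq q0.
- by near: K; exact: nbhs_pinfty_ge (num_real _).
(* The complement of [Y] is bounded by [M <= K], so a zero beyond [K] lies in [Y], hence on some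
   branch. *)
- move=> z Sz Kz; have Yz : Y z.
    apply: contrapT => /MY; apply/negP; rewrite -ltNge; apply: le_lt_trans Kz.
    by near: K; exact: nbhs_pinfty_ge (num_real _).
  have [i _ Gz] : (\bigcup_i Gamma i) z by rewrite -SY.
  suff H : forall i z, Gamma i z -> K < rnorm z -> rnorm z `^ nu <= K * rnorm (polymap f z).
    exact: H Gz Kz.
  by near: K.
Unshelve. all: by end_near. Qed.
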